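(* Let $n\ge 2$ and let $P(z)=a_1z+\dots+a_nz^n$ with $a_k\in\mathbb{R}$ for $1\le k\le n$, $a_1>0$ and $a_n\ne0$. Then $$J(P)^2=4(-1)^{n-1}a_1^{n(n-1)}\,\mathcal{R}(P',{P'}^* )\,P'(-1)\,P'(1).$$
   Context: Let $\mathbb{D}$ be the open unit disk in $\mathbb{C}$. For a polynomial $P(z)=a_1z+\dots+a_nz^n$ and an integer $k\ge0$, the complex moment is $$M_k(P)=\frac{i}{2\pi}\iint_{\mathbb{D}}P(z)^k|P'(z)|^2\,dz\wedge d\overline{z}=\frac1\pi\iint_{\mathbb{D}}P(z)^k|P'(z)|^2\,dx\,dy .$$ For real coefficients, $M_k(P)$ is a real polynomial function of $(a_1,\dots,a_n)$. The moment mapping is $\mu(P)=(M_0(P),\dots,M_{n-1}(P))$, regarded as a function of $(a_1,\dots,a_n)$, and its Jacobian is $$J(P)=\det d\mu(P)=\det\left[\frac{\partial M_k(P)}{\partial a_\nu}\right]_{0\le k\le n-1,\ 1\le\nu\le n}.$$ For a polynomial $A(z)=\alpha_0+\alpha_1z+\dots+\alpha_pz^p$ of degree $p$, the reciprocal polynomial is $A^*(z)=z^pA(1/z)$. For two polynomials $A(z)=A_p\prod_{i=1}^p(z-\alpha_i)$ and $B(z)=B_p\prod_{j=1}^p(z-\beta_j)$ of the same degree $p$, the resultant is $\mathcal{R}(A,B)=A_p^pB_p^p\prod_{i,j=1}^p(\alpha_i-\beta_j)$. *)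

(* Defs.v *)
From HB Require Import structures.
From mathcomp Require Import all_boot all_order all_algebra.
From mathcomp Require Import complex.
From mathcomp Require Import all_classical all_reals all_analysis.

Set Implicit Arguments.
Unset Strict Implicit.
Unset Printing Implicit Defensive.

Import Order.TTheory GRing.Theory Num.Theory.
Import numFieldNormedType.Exports.

Local Open Scope ring_scope.
Local Open Scope complex_scope.
Local Open Scope classical_set_scope.

(* The roots of [A], listed with multiplicity (junk list if [A = 0]). *)
Definition roots_of (F : closedFieldType) (A : {poly F}) : seq F :=
  sval (closed_field_poly_normal A).

Lemma roots_ofE (F : closedFieldType) (A : {poly F}) :
  A = lead_coef A *: \prod_(x <- roots_of A) ('X - x%:P).
Proof. exact: svalP (closed_field_poly_normal A). Qed.

(* The resultant as a product over pairs of roots. When [A] and [B] have the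
   same degree [p], both exponents are [p]. Note that [mxpoly.resultant] is
   instead the determinant of a Sylvester matrix. *)
Definition root_resultant (F : closedFieldType) (A B : {poly F}) : F :=
  lead_coef A ^+ (size B).-1 * lead_coef B ^+ (size A).-1 *
  \prod_(x <- roots_of A) \prod_(y <- roots_of B) (x - y).

(* [z ^ p * A (1 / z)] with [p = deg A]; see [horner_reciprocal]. *)
Definition reciprocal (F : fieldType) (A : {poly F}) : {poly F} :=
  \sum_(i < size A) A`_i *: 'X^((size A).-1 - i).

Lemma horner_reciprocal (F : fieldType) (A : {poly F}) (z : F) : z != 0 ->
  (reciprocal A).[z] = z ^+ (size A).-1 * A.[z^-1].
Proof.
move=> z0; rewrite /reciprocal horner_sum horner_coef mulr_sumr.
apply: eq_bigr => i _; rewrite hornerZ hornerXn mulrCA; congr (_ * _).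
have ip : (i <= (size A).-1)%N.
  by rewrite -ltnS prednK // (leq_ltn_trans _ (ltn_ord i)).
by rewrite exprVn expfB_cond // (negbTE z0).
Qed.

Definition unit_disk (R : realType) : set (R * R) :=
  [set p | `|p.1 +i* p.2| < 1].

(* Integral over the unit disk, with respect to the area measure [dx dy], of a
   complex-valued function of [z = x + i y], computed componentwise. *)
Definition disk_integral (R : realType) (f : R[i] -> R[i]) : R[i] :=
  (\int[(@lebesgue_measure R \x @lebesgue_measure R)%E]_(p in @unit_disk R)
     complex.Re (f (p.1 +i* p.2))) +i*
  (\int[(@lebesgue_measure R \x @lebesgue_measure R)%E]_(p in @unit_disk R)
     complex.Im (f (p.1 +i* p.2))).

Definition complex_moment (R : realType) (k : nat) (P : {poly R[i]}) : R[i] :=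
  (pi^-1)%:C * disk_integral (fun z => P.[z] ^+ k * `|P^`().[z]| ^+ 2).

(* [a_1 z + ... + a_n z ^ n], where the entry [a 0 v] is [a_(v + 1)]. *)
Definition poly_of (R : realType) (n : nat) (a : 'rV[R]_n) : {poly R} :=
  \sum_(v < n) a 0 v *: 'X^(v.+1).

Lemma coef_poly_of (R : realType) (n : nat) (a : 'rV[R]_n) (v : 'I_n) :
  (poly_of a)`_(v.+1) = a 0 v.
Proof.
rewrite /poly_of coef_sum (bigD1 v) //= coefZ coefXn eqxx mulr1 big1 ?addr0 //.
move=> i iv; rewrite coefZ coefXn eqSS eq_sym.
by rewrite (negbTE (_ : i != v :> nat)) ?mulr0.
Qed.

Definition complexify (R : realType) (P : {poly R}) : {poly R[i]} :=
  map_poly (real_complex R) P.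

(* The moments of a polynomial with real coefficients are real, since the disk
   is stable under conjugation, so taking the real part loses nothing. *)
Definition real_moment (R : realType) (n k : nat) (a : 'rV[R]_n) : R :=
  complex.Re (complex_moment k (complexify (poly_of a))).

Definition moment_jacobian (R : realType) (n : nat) (a : 'rV[R]_n) : R :=
  \det (\matrix_(k < n, v < n)
          'D_(delta_mx 0 v) (@real_moment R n k) a).

(* Main.v *)
Require Import Defs.
From mathcomp Require Import all_boot all_order all_algebra.
From mathcomp Require Import complex.
From mathcomp Require Import all_classical all_reals all_analysis.
From mathcomp Require Import measurable_realfun zify ring lra.
Import Order.TTheory GRing.Theory Num.Theory.
Import numFieldNormedType.Exports.
Local Open Scope ring_scope.
Local Open Scope complex_scope.

Set Implicit Arguments.
Unset Strict Implicit.
Unset Printing Implicit Defensive.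

(** Write [p] for [P'] and [m = n - 1]; [CT] denotes the constant term of a
Laurent polynomial.

On the unit disk the integral of [z ^ i * zbar ^ j] is [pi / (i + 1)] if
[i = j] and [0] otherwise ([disk_integral_zmonom]). Indeed, the function
[(1 - z zbar) z ^ i zbar ^ j] vanishes on the circle, so by Fubini and the
fundamental theorem of calculus on each chord its [zbar]-derivative has integral
zero; this is a recurrence that reduces everything to the area of the disk.
Hence [M_k = CT (z P ^ k P'(z) P(1/z))], a polynomial in the coefficients of [P].

Differentiating in the direction of [a_(i + 1)] and integrating by parts
([CT (z f') = 0]) gives [CT (P ^ k u_i)], where
[u_i = z ^ i p(1/z) + z ^ (-i) p(z)] is a symmetric Laurent polynomial
([derive_real_moment]). As [P ^ k] starts with [a_1 ^ k z ^ k], the Jacobian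
matrix is a triangular matrix with diagonal [a_1 ^ k] times the matrix of the
coefficients of the [u_i], whose entries are [p_(i - j) + p_(i + j)]
([moment_jacobianE]). This explains the power of [a_1], and reduces the theorem
to the determinant of a Toeplitz-plus-Hankel matrix attached to [p].

To compute that determinant, evaluate the [u_i] at the roots [al_k] of [p] and
at [1]. Since [p(al_k) = 0], the values are [al_k ^ i p(1/al_k)] and [2 p(1)]: a
Vandermonde matrix with rescaled columns. On the other side, the matrix of
the values of [1] and of the [w ^ j + w ^ (-j)], which are monic polynomials
in [w + 1/w], is up to a unitriangular factor the Vandermonde matrix of the
[w + 1/w]. Dividing the two determinants yields
[det ^ 2 = 4 c ^ (2 m + 2) prod_(i, j) (al_i al_j - 1) prod_i (al_i ^ 2 - 1)],
with [c] the leading coefficient of [p] ([det_toeplitz_hankel_mx_sqr]). The double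
product is the resultant of [p] and its reciprocal, and the simple one is
[p(1) p(-1)], up to signs and powers of [c]
([det_toeplitz_hankel_mx_resultant]).

The division needs the roots to be in general position. The general case follows
by moving them along generic lines and specializing the resulting polynomial
identity. *)

(** * The Toeplitz-plus-Hankel matrix of a polynomial *)

Definition toeplitz_hankel_mx (S : nzRingType) (m : nat) (p : {poly S}) : 'M[S]_m.+1 :=
  \matrix_(i, j) ((if (j <= i)%N then p`_(i - j) else 0) + p`_(i + j)).

Lemma map_toeplitz_hankel_mx (S T : nzRingType) (f : {rmorphism S -> T}) m (p : {poly S}) :
  toeplitz_hankel_mx m (map_poly f p) = map_mx f (toeplitz_hankel_mx m p).
Proof.
apply/matrixP=> i j; rewrite !mxE !coef_map rmorphD.
by case: ifP => _; rewrite ?rmorph0.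
Qed.

(** Row [i] holds the coefficients, in the basis [1, w + 1/w, w^2 + 1/w^2, ...]
of the symmetric Laurent polynomials, of [w ^ i p(1/w) + w ^ (-i) p(w)]. The
condition on the size of [p] makes these have degree at most [m]. *)
Lemma toeplitz_hankel_mx_Laurent (F : fieldType) m (p : {poly F}) (w : F) (i : 'I_m.+1) :
  (size p <= m.+1)%N -> w != 0 ->
  \sum_(j < m.+1) toeplitz_hankel_mx m p i j * (if j == 0 :> nat then 1 else w ^+ j + w ^- j)
    = w ^+ i * p.[w^-1] + w ^- i * p.[w].
Proof.
move=> sp w0.
rewrite !(horner_coef_wide _ sp) !mulr_sumr -big_split /=.
pose G d : F := w ^+ d + w ^- d.
have -> : \sum_(l < m.+1) (w ^+ i * (p`_l * w^-1 ^+ l) + w ^- i * (p`_l * w ^+ l))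
  = \sum_(l < m.+1) p`_l * G (i - l + (l - i))%N.
  apply: eq_bigr => l _; rewrite /G exprVn; case: (leqP l i) => li.
    rewrite (_ : l - i = 0)%N ?addn0; last lia.
    rewrite expfB_cond ?(negPf w0) //; field.
    by rewrite !expf_neq0.
  rewrite (_ : i - l = 0)%N ?add0n; last lia.
  rewrite expfB_cond ?(negPf w0) ?(ltnW li) //; field.
  by rewrite !expf_neq0.
(* Both sides are linear in [p]: expanding the entries on the coefficients of
   [p] leaves one identity for each monomial ['X^l], where only the column of
   index [`|i - l|] contributes. *)
have pE k : p`_k = \sum_(l < m.+1) p`_l * (k == l)%:R.
  case: (ltnP k m.+1) => km.
    rewrite (bigD1 (Ordinal km)) //= eqxx mulr1 big1 ?addr0 // => l lk.
    by rewrite (_ : k == l = false) ?mulr0 //; apply: contraNF lk => /eqP kl; apply/eqP/val_inj.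
  rewrite nth_default ?(leq_trans sp) // big1 // => l _.
  by rewrite (_ : k == l = false) ?mulr0 //; have := ltn_ord l; lia.
pose e j : F := if j == 0%N then 1 else G j.
transitivity (\sum_(j < m.+1) \sum_(l < m.+1)
    p`_l * (((j <= i) && (i - j == l))%N%:R + (i + j == l)%N%:R) * e j).
  apply: eq_bigr => j _; rewrite mxE -mulr_suml; congr (_ * _).
  rewrite (pE (i + j)%N); case: ifP => ji /=; last first.
    by rewrite add0r; apply: eq_bigr => l _; rewrite add0r.
  by rewrite pE -big_split; apply: eq_bigr => l _; rewrite mulrDr.
rewrite exchange_big; apply: eq_bigr => l _ /=.
have dm : (i - l + (l - i) < m.+1)%N by have := ltn_ord i; have := ltn_ord l; lia.
rewrite (bigD1 (Ordinal dm)) //= big1 ?addr0 => [|j jd].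
  rewrite /e /G; case: (ltngtP l i) => li.
  - have -> : (i - l + (l - i) <= i)%N by lia.
    have -> : (i - (i - l + (l - i)) == l)%N by lia.
    have -> : (i + (i - l + (l - i)) == l)%N = false by lia.
    have -> : (i - l + (l - i) == 0)%N = false by lia.
    by rewrite addr0 mulr1.
  - have -> : (i - (i - l + (l - i)) == l)%N = false by lia.
    have -> : (i + (i - l + (l - i)) == l)%N by lia.
    have -> : (i - l + (l - i) == 0)%N = false by lia.
    by rewrite andbF add0r mulr1.
  - by rewrite li subnn !addn0 subn0 leq0n !eqxx expr0 invr1 mulr1.
have {}jd : j != (i - l + (l - i))%N :> nat by apply: contra jd => /eqP h; apply/eqP/val_inj.
have -> : (j <= i)%N && (i - j == l)%N = false by lia.
have -> : (i + j == l)%N = false by lia.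
by rewrite addr0 mulr0 mul0r.
Qed.

(** The rescaled Chebyshev polynomials, which obey
[T_(j + 2) = 'X T_(j + 1) - T_j]. In that recurrence the initial term is
[w ^ 0 + w ^ 0 = 2], while the polynomial of index [0] wanted here is [1];
hence the induction starts at [j = 1]. *)
Lemma exists_Chebyshev (F : fieldType) (j : nat) : exists T : {poly F},
  [/\ T \is monic, size T = j.+1 & forall w, w != 0 ->
    T.[w + w^-1] = if j == 0%N then 1 else w ^+ j + w ^- j].
Proof.
case: j => [|j]; first by exists 1; split; rewrite ?monic1 ?size_poly1 // => w _; rewrite hornerC.
suff H : forall j, exists T T' : {poly F},
  [/\ T \is monic /\ T' \is monic, size T = j.+2, size T' = j.+3 & forall w, w != 0 ->
    T.[w + w^-1] = w ^+ j.+1 + w ^- j.+1 /\ T'.[w + w^-1] = w ^+ j.+2 + w ^- j.+2].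
  by have [T [T' [[h1 _] h2 _ h3]]] := H j; exists T; split=> // w /h3[].
elim=> {j}[|j [T [T' [[mT mT'] sT sT' h]]]].
  have sz : size ('X^2 - 2%:P : {poly F}) = 3%N.
    by rewrite size_polyDl size_polyXn // size_polyN (leq_ltn_trans (size_polyC_leq1 _)).
  exists 'X, ('X^2 - 2%:P); split=> //.
  - by split; rewrite ?monicX // monicE /lead_coef sz /= coefB coefXn coefC subr0.
  - by rewrite size_polyX.
  move=> w w0; rewrite !hornerE; split=> //; by field.
exists T', ('X * T' - T).
have sz : size ('X * T' - T) = j.+4.
  have sXT : size ('X * T') = j.+4 by rewrite mulrC size_mulX ?sT' // -size_poly_eq0 sT'.
  by rewrite size_polyDl ?size_polyN sXT ?sT.
split=> //; first split=> //.
  rewrite monicE /lead_coef sz /= coefB mulrC coefMX /=.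
  rewrite [T`_ _]nth_default ?sT // subr0.
  by move: mT'; rewrite monicE /lead_coef sT'.
move=> w w0; have [h1 h2] := h w w0; split=> //.
rewrite !hornerE h1 h2 !exprS; field.
by rewrite w0 expf_neq0.
Qed.

(** The matrix is the Vandermonde matrix of the [w + 1/w] multiplied by the
unitriangular matrix of the coefficients of the Chebyshev polynomials, and
[v + 1/v - (u + 1/u) = (v - u) (1 - 1/(u v))]. *)
Lemma det_Chebyshev (F : fieldType) n (w : 'rV[F]_n) : (forall k, w 0 k != 0) ->
  \det (\matrix_(j < n, k < n)
     (if j == 0 :> nat then 1 else w 0 k ^+ j + w 0 k ^- j)) =
  \prod_(i < n) \prod_(j < n | (i < j)%N)
     ((w 0 j - w 0 i) * (1 - (w 0 i * w 0 j)^-1)).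
Proof.
move=> w0; have [T HT] := fin_all_exists (fun j : 'I_n => @exists_Chebyshev F j).
pose s := \row_k (w 0 k + (w 0 k)^-1).
have -> : \matrix_(j < n, k < n)
     (if j == 0 :> nat then 1 else w 0 k ^+ j + w 0 k ^- j) =
  (\matrix_(j < n, l < n) (T j)`_l) *m Vandermonde n s.
  apply/matrixP=> j k; rewrite !mxE; have [_ sT <- //] := HT j.
  rewrite (horner_coef_wide _ (_ : (_ <= n)%N)) ?sT //.
  by apply: eq_bigr => l _; rewrite !mxE.
have trigT : is_trig_mx (\matrix_(j < n, l < n) (T j)`_l).
  apply/is_trig_mxP => i j ij; rewrite mxE; have [_ sT _] := HT i.
  by rewrite nth_default ?sT.
have detT : \det (\matrix_(j < n, l < n) (T j)`_l) = 1.
  rewrite det_trig // big1 // => j _; rewrite mxE.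
  by have [/monicP mT sT _] := HT j; rewrite -mT /lead_coef sT.
rewrite det_mulmx detT mul1r det_Vandermonde.
apply: eq_bigr => i _; apply: eq_bigr => j _; rewrite !mxE; field.
by rewrite !w0.
Qed.


(** * Its determinant in terms of the roots *)

Lemma prod_symmetric (S : comNzRingType) m (f : 'I_m -> 'I_m -> S) :
  (forall i j, f i j = f j i) ->
  \prod_i \prod_j f i j =
  (\prod_(i < m) \prod_(j < m | (i < j)%N) f i j) ^+ 2 * \prod_i f i i.
Proof.
move=> fC; rewrite expr2 -mulrA.
have E : (\prod_(i < m) \prod_(j < m | (i < j)%N) f i j) * \prod_(i < m) f i i =
  \prod_(i < m) \prod_(j < m | (j <= i)%N) f i j.
  rewrite [X in X * _](exchange_big_dep xpredT) //= -big_split /=.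
  apply: eq_bigr => i _; rewrite [RHS](bigD1 i) //= mulrC; congr (_ * _).
  apply: eq_big => [j|j _]; last exact: fC.
  by rewrite ltn_neqAle andbC.
rewrite {}E -big_split; apply: eq_bigr => i _ /=.
rewrite (bigID (fun j : 'I_m => (i < j)%N)) /=; congr (_ * _).
by apply: eq_bigl => j; rewrite -leqNgt.
Qed.

Definition root_poly (S : comNzRingType) m (c : S) (al : 'I_m -> S) : {poly S} :=
  c *: \prod_i ('X - (al i)%:P).

Lemma horner_root_poly (S : comNzRingType) m (c : S) (al : 'I_m -> S) x :
  (root_poly c al).[x] = c * \prod_i (x - al i).
Proof.
by rewrite hornerZ horner_prod; under eq_bigr do rewrite hornerXsubC.
Qed.

(** Comparing determinants after evaluating the Laurent polynomials of the rows
at the roots [al i] and at [1]; the common factor cancelled is the Vandermonde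
determinant of these points. The point [1] supplies the missing [m + 1]-st
evaluation, and is responsible for the factors [1 - 1/al i]. *)
Lemma det_toeplitz_hankel_mx_evaluation (F : fieldType) m (c : F) (al : 'I_m -> F) :
  injective al -> (forall i, al i != 0) -> (forall i, al i != 1) ->
  let p := root_poly c al in
  \det (toeplitz_hankel_mx m p) *
    ((\prod_(i < m) \prod_(j < m | (i < j)%N) (1 - (al i * al j)^-1)) *
      \prod_i (1 - (al i)^-1)) =
  2 * p.[1] * \prod_i p.[(al i)^-1].
Proof.
move=> alI al0 al1 p.
pose w := \row_(k < m.+1) oapp al 1 (insub (k : nat)).
have wl i : w 0 (widen_ord (leqnSn m) i) = al i by rewrite mxE /= valK.
have wm : w 0 ord_max = 1 by rewrite mxE insubF //= ltnn.
have ordP (P : 'I_m.+1 -> Prop) :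
    (forall i, P (widen_ord (leqnSn m) i)) -> P ord_max -> forall k, P k.
  move=> Pl Pm k; case: (ltnP k m) => km.
    by rewrite (_ : k = widen_ord (leqnSn m) (Ordinal km)) //; apply/val_inj.
  rewrite (_ : k = ord_max) //; apply/val_inj/eqP; rewrite eqn_leq km /=.
  by have := ltn_ord k; rewrite ltnS => ->.
have wN i : widen_ord (leqnSn m) i == ord_max = false.
  by apply/eqP => /(congr1 val) /= im; have := ltn_ord i; rewrite im ltnn.
have w0 k : w 0 k != 0.
  by elim/ordP: k => [i|]; rewrite ?wl ?wm ?oner_neq0.
have root_p i : p.[al i] = 0.
  by rewrite horner_root_poly (bigD1 i) //= subrr mul0r mulr0.
pose d := \row_k (if (k == ord_max :> 'I_m.+1) then 2 * p.[1] else p.[(w 0 k)^-1]).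
have sp : (size p <= m.+1)%N.
  rewrite (leq_trans (size_scale_leq _ _)) // size_prod_XsubC.
  by rewrite /index_enum -enumT size_enum_ord.
have /(congr1 (fun A => \det A)) : toeplitz_hankel_mx m p *m \matrix_(j < m.+1, k < m.+1)
     (if j == 0 :> nat then 1 else w 0 k ^+ j + w 0 k ^- j) =
   Vandermonde m.+1 w *m diag_mx d.
  apply/matrixP=> i k; rewrite mul_mx_diag mxE [RHS]mxE [Vandermonde _ _ _ _]mxE [d _ _]mxE.
  under eq_bigr => j _ do rewrite [X in _ * X]mxE.
  rewrite toeplitz_hankel_mx_Laurent //.
  elim/ordP: k => [k|].
    by rewrite wl root_p mulr0 addr0 wN.
  by rewrite wm eqxx !expr1n invr1 !mul1r mulr_natl mulr2n.
rewrite !det_mulmx det_Vandermonde det_Chebyshev // det_diag => E.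
move: E; rewrite (eq_bigr _ (fun i _ => big_split _ _ _ _ _)) big_split /=.
rewrite mulrCA => /mulfI H.
rewrite [RHS](_ : _ = \prod_i d 0 i).
  rewrite -H; last first.
    apply/prodf_neq0 => i _; apply/prodf_neq0 => j; rewrite subr_eq0.
    elim/ordP: j => [j|]; elim/ordP: i => [i|] /=; rewrite ?wl ?wm => ij.
    - by apply: contraTneq ij => /alI ->; rewrite ltnn.
    - by move: ij; rewrite ltnNge ltnW.
    - by rewrite eq_sym.
    - by rewrite ltnn in ij.
  congr (_ * _); rewrite big_ord_recr /= [X in _ = _ * X]big_pred0 ?mulr1; last first.
    by move=> j; apply/negbTE; rewrite -leqNgt -ltnS.
  rewrite -big_split /=; apply: eq_bigr => i _.
  rewrite big_mkcond [RHS]big_mkcond [RHS]big_ord_recr /= ltn_ord wm wl mulr1.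
  by congr (_ * _); apply: eq_bigr => j _; rewrite wl.
rewrite big_ord_recr /= mulrC; congr (_ * _); last by rewrite mxE eqxx.
apply: eq_bigr => i _; by rewrite mxE wN wl.
Qed.

(** Each factor of the evaluated identity is a product of the
[1 - 1/(al_i al_j)], and squaring removes the signs and the asymmetry between
the pairs [i < j] and [j < i]. *)
Lemma det_toeplitz_hankel_mx_generic (F : fieldType) m (c : F) (al : 'I_m -> F) :
  injective al -> (forall i, al i != 0) -> (forall i, al i != 1) ->
  (forall i j, i != j -> al i * al j != 1) ->
  \det (toeplitz_hankel_mx m (root_poly c al)) ^+ 2 =
  4 * c ^+ (m.+1).*2 * (\prod_i \prod_j (al i * al j - 1)) *
    \prod_i (al i ^+ 2 - 1).
Proof.
move=> alI al0 al1 al2.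
have /= := det_toeplitz_hankel_mx_evaluation c alI al0 al1.
set D := \det _; rewrite horner_root_poly.
rewrite (eq_bigr _ (fun i _ => horner_root_poly c al (al i)^-1)).
set G := \prod_(i < m) _; set H := \prod_i (1 - _).
pose A := \prod_i al i.
have A0 : A != 0 by apply/prodf_neq0 => i _.
have H0 : H != 0.
  by apply/prodf_neq0 => i _; rewrite subr_eq0 eq_sym invr_eq1.
have G0 : G != 0.
  apply/prodf_neq0 => i _; apply/prodf_neq0 => j ij.
  rewrite subr_eq0 eq_sym invr_eq1 al2 //.
  by apply: contraTneq ij => ->; rewrite ltnn.
pose K := \prod_i (1 - (al i ^+ 2)^-1).
have EGK : \prod_i \prod_j (1 - (al i * al j)^-1) = G ^+ 2 * K.
  by rewrite prod_symmetric // => i j; rewrite mulrC.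
have constE (x : F) : \prod_(i < m) x = x ^+ m by rewrite prodr_const card_ord.
have -> : \prod_i (1 - al i) = (-1) ^+ m * A * H.
  rewrite -constE -!big_split /=.
  by apply: eq_bigr => i _; field.
have -> : \prod_i (c * \prod_j ((al i)^-1 - al j)) =
   c ^+ m * ((-1) ^+ (m * m) * A ^+ m * (G ^+ 2 * K)).
  rewrite big_split constE -EGK -mulrA exprM -!constE -!big_split /=.
  apply: eq_bigr => i _; congr (_ * _).
  rewrite -!big_split /=; apply: eq_bigr => j _; field.
  by rewrite !al0.
have -> : \prod_i \prod_j (al i * al j - 1) = A ^+ m.*2 * (G ^+ 2 * K).
  rewrite -addnn exprD -EGK -mulrA -{1}prodrXl -constE -!big_split /=.
  apply: eq_bigr => i _; rewrite -constE -!big_split /=.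
  by apply: eq_bigr => j _; field; rewrite !al0.
have -> : \prod_i (al i ^+ 2 - 1) = A ^+ 2 * K.
  rewrite -prodrXl -big_split /=.
  by apply: eq_bigr => i _; field.
move=> E; have {E} -> : D = 2 * c * A * (-1) ^+ m * (c ^+ m * ((-1) ^+ (m * m) * A ^+ m * (G * K))).
  apply: (mulIf (mulf_neq0 G0 H0)); rewrite E; ring.
rewrite !exprMn !sqrr_sign -![_ ^+ m ^+ 2]exprM !muln2 doubleS !exprS; ring.
Qed.

(** The identity sought is that this defect vanishes. A defect, being natural in
the ring, can be moved to a field of rational functions and back. *)
Definition det_sqr_defect (S : comNzRingType) m (c : S) (al : 'I_m -> S) : S :=
  \det (toeplitz_hankel_mx m (root_poly c al)) ^+ 2 -
  4 * c ^+ (m.+1).*2 * (\prod_i \prod_j (al i * al j - 1)) *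
    \prod_i (al i ^+ 2 - 1).

Lemma rmorph_det_sqr_defect (S T : comNzRingType) (f : {rmorphism S -> T}) m
    (c : S) (al : 'I_m -> S) :
  f (det_sqr_defect c al) = det_sqr_defect (f c) (f \o al).
Proof.
have fp : map_poly f (root_poly c al) = root_poly (f c) (f \o al).
  rewrite map_polyZ rmorph_prod; congr (_ *: _).
  by apply: eq_bigr => i _; rewrite /= map_polyXsubC.
rewrite /det_sqr_defect -fp map_toeplitz_hankel_mx det_map_mx.
rewrite rmorphB rmorphXn 3!rmorphM rmorphXn rmorph_nat !rmorph_prod.
congr (_ - _ * _ * _); apply: eq_bigr => i _.
  rewrite rmorph_prod; apply: eq_bigr => j _.
  by rewrite rmorphB rmorphM rmorph1.
by rewrite rmorphB rmorphXn rmorph1.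
Qed.

(** The roots are moved to [al i + (i + 1) t] in the field of rational
functions in [t]. The slopes are nonzero and pairwise distinct, so the moved
roots are in general position; the identity then holds in the ring of polynomials
in [t], and [t = 0] gives back the original roots. *)
Lemma det_toeplitz_hankel_mx_sqr (F : numDomainType) m (c : F) (al : 'I_m -> F) :
  \det (toeplitz_hankel_mx m (root_poly c al)) ^+ 2 =
  4 * c ^+ (m.+1).*2 * (\prod_i \prod_j (al i * al j - 1)) *
    \prod_i (al i ^+ 2 - 1).
Proof.
apply/subr0_eq; rewrite -/(det_sqr_defect c al).
pose be (i : 'I_m) := (i.+1)%:R%:P * 'X + (al i)%:P : {poly F}.
have be1 i : (be i)`_1 = (i.+1)%:R by rewrite coefD coefMX !coefC /= addr0.
have sbe i : size (be i) = 2.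
  by rewrite size_MXaddC polyC_eq0 pnatr_eq0 /= size_polyC pnatr_eq0.
have be0 i : be i != 0 by rewrite -size_poly_eq0 sbe.
have : det_sqr_defect c%:P be = 0.
  apply/eqP; rewrite -tofrac_eq0 rmorph_det_sqr_defect.
  rewrite subr_eq0; apply/eqP.
  apply: det_toeplitz_hankel_mx_generic => [i j|i|i|i j _] /=.
  - move=> /eqP; rewrite tofrac_eq => /eqP /(congr1 (fun p : {poly F} => p`_1)).
    by rewrite !be1 => /eqP; rewrite eqr_nat eqSS => /eqP /val_inj.
  - by rewrite tofrac_eq0.
  - rewrite -tofrac1 tofrac_eq; apply/eqP => /(congr1 (fun p : {poly F} => size p)).
    by rewrite sbe size_poly1.
  - rewrite -tofracM -tofrac1 tofrac_eq; apply/eqP.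
    by move=> /(congr1 (fun p : {poly F} => size p)); rewrite size_mul // !sbe size_poly1.
move/(congr1 (horner_eval 0)); rewrite rmorph0 rmorph_det_sqr_defect.
rewrite /= /horner_eval hornerC => <-.
congr (det_sqr_defect c _); apply/funext => i /=.
by rewrite /be !hornerE.
Qed.

(** * Relation with the resultant *)

Lemma size_reciprocal (F : fieldType) (p : {poly F}) :
  p`_0 != 0 -> size (reciprocal p) = size p.
Proof.
move=> p0; have sp : (0 < size p)%N.
  by rewrite lt0n size_poly_eq0; apply: contraNneq p0 => ->; rewrite coef0.
have -> : reciprocal p = \poly_(i < size p) p`_((size p).-1 - i).
  rewrite poly_def /reciprocal (reindex_inj rev_ord_inj) /=.
  apply: eq_bigr => i _.
  have aux k s : (k < s -> s.-1 - (s - k.+1) = k)%N by lia.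
  by rewrite aux // -(subn1 (size p)) -subnDA.
rewrite size_poly_eq //.
by rewrite subnn.
Qed.

(** The product over the roots of [reciprocal p] is an evaluation of
[reciprocal p], at a root of [p], hence equal to
[c * \prod_j (1 - al_i * al_j)]; and
[p(1) p(-1) = c^2 \prod_i (al_i ^ 2 - 1)]. The sign comes from the [m ^ 2]
factors of the double product, [m ^ 2] and [m] having the same parity. *)
Lemma det_toeplitz_hankel_mx_resultant (F : numClosedFieldType) m (p : {poly F}) :
  size p = m.+1 -> p`_0 != 0 ->
  \det (toeplitz_hankel_mx m p) ^+ 2 =
  4 * (-1) ^+ m * root_resultant p (reciprocal p) * p.[-1] * p.[1].
Proof.
move=> sp p0; set c := lead_coef p.
have pE : p = c *: \prod_(x <- roots_of p) ('X - x%:P) := roots_ofE p.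
have c0 : c != 0 by rewrite lead_coef_eq0 -size_poly_eq0 sp.
have sr : size (roots_of p) = m.
  by apply/eqP; rewrite -eqSS -sp [in X in _ == X]pE size_scale // size_prod_XsubC.
pose al (i : 'I_m) := (roots_of p)`_i.
have bigE (G : F -> F) : \prod_(x <- roots_of p) G x = \prod_i G (al i).
  by rewrite (big_nth 0) sr big_mkord.
have pal : p = root_poly c al.
  by rewrite [LHS]pE /root_poly (big_nth 0) sr big_mkord.
have pal_eval x : p.[x] = c * \prod_i (x - al i) by rewrite [in LHS]pal horner_root_poly.
have al0 i : al i != 0.
  apply: contra_neq p0 => ali; rewrite -horner_coef0 pal_eval.
  by rewrite (bigD1 i) //= ali subrr mul0r mulr0.
have sq := size_reciprocal p0.
have constE (x : F) : \prod_(i < m) x = x ^+ m by rewrite prodr_const card_ord.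
have resE : root_resultant p (reciprocal p) =
    c ^+ m * \prod_i (c * \prod_j (1 - al i * al j)).
  rewrite /root_resultant sq sp -/c /= -mulrA bigE; congr (_ * _).
  rewrite -constE -big_split /=; apply: eq_bigr => i _.
  have qE := roots_ofE (reciprocal p).
  transitivity (reciprocal p).[al i].
    rewrite [in RHS]qE hornerZ horner_prod; congr (_ * _).
    by apply: eq_bigr => x _; rewrite hornerXsubC.
  rewrite horner_reciprocal // sp pal_eval mulrCA /=; congr (_ * _).
  rewrite -constE -big_split /=; apply: eq_bigr => j _.
  by rewrite mulrBr divff.
rewrite [in LHS]pal det_toeplitz_hankel_mx_sqr resE !pal_eval.
rewrite big_split prodr_const card_ord /=.
have -> : \prod_i \prod_j (al i * al j - 1) =
    (-1) ^+ m * \prod_i \prod_j (1 - al i * al j).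
  have -> : (-1) ^+ m = \prod_(i < m) \prod_(j < m) (-1 : F).
    rewrite (eq_bigr _ (fun i _ => prodr_const _ _)) prodr_const !card_ord -exprM.
    by rewrite -[in LHS]signr_odd -[in RHS]signr_odd oddM andbb.
  rewrite -big_split; apply: eq_bigr => i _; rewrite -big_split.
  by apply: eq_bigr => j _ /=; ring.
have -> : \prod_i (al i ^+ 2 - 1) = (\prod_i (-1 - al i)) * \prod_i (1 - al i).
  by rewrite -big_split; apply: eq_bigr => i _ /=; ring.
rewrite doubleS !exprS -addnn exprD; ring.
Qed.

(** * Integration over the unit disk *)

(** For [Z = z] and [W = zbar], the factors of [Z^`()] and [W^`()] are the
derivatives in [z] and [zbar] of a function that vanishes on the unit
circle. *)
Lemma deriv_power_pair (S : comNzRingType) (Z W : {poly S}) (p q : nat) :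
  ((1 - Z * W) * (Z ^+ p * W ^+ q))^`() =
  Z^`() * (p%:R * (Z ^+ p.-1 * W ^+ q) - p.+1%:R * (Z ^+ p * W ^+ q.+1)) +
  W^`() * (q%:R * (Z ^+ p * W ^+ q.-1) - q.+1%:R * (Z ^+ p.+1 * W ^+ q)).
Proof.
have -> : (1 - Z * W) * (Z ^+ p * W ^+ q) = Z ^+ p * W ^+ q - Z ^+ p.+1 * W ^+ q.+1.
  by rewrite !exprS; ring.
rewrite derivB !derivM !deriv_exp /= -!(mulr_natr (_ * _)); ring.
Qed.

Section Disk.
Variable R : realType.
Notation leb := (@lebesgue_measure R).
Notation mu2 := (leb \x leb)%E.
Notation D := (@unit_disk R).
Local Open Scope classical_set_scope.

(** Substitute [x = sin t]; a primitive of [2 cos^2 t] is [t + sin t cos t]. *)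
Lemma integral_semicircle :
  (\int[leb]_(x in `[(-1)%R, 1%R]) (2 * Num.sqrt (1 - x ^+ 2))%:E = pi%:E)%E.
Proof.
have h0 : - (pi / 2) < pi / 2 :> R by rewrite gtrN // divr_gt0 ?pi_gt0.
have s1 : sin (pi / 2) = 1 :> R := sin_pihalf R.
have s2 : sin (- (pi / 2)) = -1 :> R by rewrite sinN s1.
have dsin : (sin : R -> R)^`() = cos.
  by apply/funext => x; rewrite derive1E derive_val.
rewrite -[X in BRight X]s1 -[X in BLeft X]s2 (@integration_by_substitution_increasing R sin); first last.
- apply: continuous_subspaceT => x.
  apply: cvgM; first exact: cvg_cst.
  apply: continuous_comp; last exact: sqrt_continuous.
  by apply: cvgB; [exact: cvg_cst|exact: exprn_continuous].
- split.
  + by move=> x _; exact: derivable_sin.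
  + by apply: cvg_at_right_filter; exact: continuous_sin.
  + by apply: cvg_at_left_filter; exact: continuous_sin.
- rewrite dsin; apply/cvg_ex; exists (cos (pi / 2)).
  by apply: cvg_at_left_filter; exact: continuous_cos.
- rewrite dsin; apply/cvg_ex; exists (cos (- (pi / 2))).
  by apply: cvg_at_right_filter; exact: continuous_cos.
- by rewrite dsin => x _; apply: continuous_cos.
- by move=> x y xi yi; rewrite ltr_sin.
- exact: ltW.
transitivity (\int[leb]_(x in `[(- (pi / 2))%R, (pi / 2)%R]) (2 * cos x ^+ 2)%:E)%E.
  apply: eq_integral => x; rewrite inE /= in_itv /= => xi.
  rewrite dsin /GRing.mul /= -cos2sin2 sqrtr_sqr ger0_norm ?cos_ge0_pihalf //.
  by rewrite -mulrA.
rewrite (@continuous_FTC2 R _ (fun t => t + sin t * cos t) _ _ h0).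
- have -> : pi / 2 + sin (pi / 2) * cos (pi / 2) = pi / 2 :> R.
    by rewrite cos_pihalf mulr0 addr0.
  rewrite cosN cos_pihalf mulr0 addr0 -EFinB; congr (_%:E); by field.
- apply: (@continuous_subspaceT _ _ _ (fun x : R => 2 * cos x ^+ 2)) => x.
  by apply/differentiable_continuous/derivable1_diffP.
- have dF x : derivable (fun t : R => t + sin t * cos t) x 1 by [].
  have cF x : {for x, continuous (fun t : R => t + sin t * cos t)}.
    by apply/differentiable_continuous/derivable1_diffP.
  split=> [x _ //||]; [exact/cvg_at_right_filter/cF|exact/cvg_at_left_filter/cF].
- move=> x _ /=; rewrite derive1E derive_val /GRing.scale /=.
  have := cos2Dsin2 x; nra.
Qed.

Lemma unit_diskE (x y : R) : D (x, y) <-> x ^+ 2 + y ^+ 2 < 1.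
Proof.
rewrite /unit_disk /= normc_def ltcR /= -[X in _ < X]sqrtr1 ltr_sqrt //.
Qed.

(** The section of the unit disk at abscissa (or ordinate) [s]. It is empty when
[1 <= `|s|], the square root of a negative number being [0]. *)
Definition chord (s : R) : set R :=
  [set` `](- Num.sqrt (1 - s ^+ 2)), (Num.sqrt (1 - s ^+ 2))[%R].

Lemma chordE (s t : R) : chord s t <-> s ^+ 2 + t ^+ 2 < 1.
Proof.
rewrite /chord /= in_itv /= -ltr_norml; case: (lerP 0 (1 - s ^+ 2)) => h.
  rewrite -(ltr_sqr (normr_ge0 t) (sqrtr_ge0 _)) // sqr_sqrtr // real_normK ?num_real //.
  by rewrite ltrBrDl.
rewrite ler0_sqrtr ?ltW //; split; first by rewrite ltNge normr_ge0.
by have := sqr_ge0 t; lra.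
Qed.

Lemma measurable_unit_disk : measurable D.
Proof.
have -> : D = setT `&` (fun p : R * R => p.1 ^+ 2 + p.2 ^+ 2) @^-1` `]-oo, 1[.
  by rewrite setTI; apply/seteqP; split=> -[x y] /=; rewrite in_itv /= => /unit_diskE.
have m : measurable_fun setT (fun p : R * R => p.1 ^+ 2 + p.2 ^+ 2).
  by apply: measurable_funD; apply: measurable_funX; [exact: measurable_fst|exact: measurable_snd].
by apply: m => //; exact: measurable_itv.
Qed.

Lemma xsection_unit_disk (x : R) : xsection D x = chord x.
Proof.
apply/seteqP; split=> y; rewrite xsectionE /=.
  by move/unit_diskE/chordE.
by move=> h; apply/unit_diskE/chordE.
Qed.

Lemma area_unit_disk : mu2 D = pi%:E.
Proof.
rewrite -integral_semicircle [LHS]/product_measure1 /=.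
rewrite [RHS]integral_mkcond; apply: eq_integral => x _.
rewrite /= xsection_unit_disk /chord lebesgue_measure_itv /= lte_fin.
set r := Num.sqrt _; have r0 : 0 <= r := sqrtr_ge0 _.
have -> : (if (- r < r)%R then r%:E - (- r)%R%:E else 0)%E = (2 * r)%:E.
  case: ifPn => [_|]; first by rewrite -EFinB opprK mulr2n mulrDl mul1r.
  by rewrite -leNgt => rr; have -> : r = 0; [lra|rewrite mulr0].
rewrite patchE; case: ifPn => // /negP x1.
have -> : r = 0.
  apply/ler0_sqrtr; rewrite subr_le0 leNgt; apply/negP => h; apply: x1.
  rewrite inE /= in_itv /= -ler_norml.
  by rewrite -(@expr_le1 _ 2) // real_normK ?num_real // ltW.
by rewrite mulr0.
Qed.

(** A class of integrable functions on the disk that is stable under products;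
it contains the polynomial functions, which are the only ones integrated
below. *)
Definition disk_tame (g : R * R -> R) :=
  measurable_fun setT g /\ exists M, forall p, D p -> `|g p| <= M.

Lemma disk_tame_integrable g : disk_tame g -> mu2.-integrable D (EFin \o g).
Proof.
case=> mg [M gM]; apply: measurable_bounded_integrable.
- exact: measurable_unit_disk.
- by rewrite [X in (X < _)%E]area_unit_disk ltry.
- exact: measurable_funTS.
- exists M; split; first exact: num_real.
  by move=> N MN p Dp; apply: (le_trans (gM p Dp)); exact: ltW.
Qed.

Lemma restrict_disk_integrable g : disk_tame g ->
  mu2.-integrable setT (EFin \o (g \_ D)).
Proof.
move=> tg; rewrite -restrict_EFin.
have := disk_tame_integrable tg.
by rewrite integrable_mkcond //; exact: measurable_unit_disk.
Qed.

(** Fubini, integrating first along vertical chords. *)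
Lemma disk_integral_eq0_x g : disk_tame g ->
  (forall x, \int[leb]_(y in chord x) (g (x, y))%:E = 0)%E ->
  \int[mu2]_(p in D) g p = 0.
Proof.
move=> tg h; rewrite Rintegral_mkcond /Rintegral.
rewrite -(integral12_prod_meas1 (restrict_disk_integrable tg)).
rewrite integral0_eq // => x _; rewrite /fubini_F -[RHS](h x) [RHS]integral_mkcond.
apply: eq_integral => y _; rewrite /= !patchE [LHS]fun_if; congr (if _ then _ else _).
apply/idP/idP; rewrite !inE; first by move/unit_diskE/chordE.
by move/chordE/unit_diskE.
Qed.

(** Fubini, integrating first along horizontal chords. *)
Lemma disk_integral_eq0_y g : disk_tame g ->
  (forall y, \int[leb]_(x in chord y) (g (x, y))%:E = 0)%E ->
  \int[mu2]_(p in D) g p = 0.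
Proof.
move=> tg h; rewrite Rintegral_mkcond /Rintegral.
rewrite -(integral21_prod_meas1 (restrict_disk_integrable tg)).
rewrite integral0_eq // => y _; rewrite /fubini_G -[RHS](h y) [RHS]integral_mkcond.
apply: eq_integral => x _; rewrite /= !patchE [LHS]fun_if; congr (if _ then _ else _).
apply/idP/idP; rewrite !inE.
  by move/unit_diskE => Dxy; apply/chordE; rewrite addrC.
by move/chordE => Dxy; apply/unit_diskE; rewrite addrC.
Qed.

Local Open Scope ring_scope.

Lemma integral_deriv_poly (h : {poly R}) (r : R) : 0 <= r -> h.[- r] = h.[r] ->
  (\int[leb]_(y in [set` `](- r), r[%R]) (h^`().[y])%:E = 0)%E.
Proof.
rewrite le_eqVlt => /predU1P[<- _|r0 hr].
  by rewrite oppr0 set_itvoo0 integral_set0.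
have cp (p : {poly R}) : continuous (horner p).
  by move=> x; apply/differentiable_continuous/derivable1_diffP; exact: derivable_horner.
rewrite integral_itv_obnd_cbnd; last first.
  by apply/measurable_EFinP; apply: measurable_funTS; apply: continuous_measurable_fun.
rewrite integral_itv_bndo_bndc; last first.
  by apply/measurable_EFinP; apply: measurable_funTS; apply: continuous_measurable_fun.
rewrite (@continuous_FTC2 R _ (horner h)) ?hr ?subee //.
- by rewrite gtrN.
- by apply: continuous_subspaceT; exact: cp.
- split=> [y _||]; [exact: derivable_horner|exact/cvg_at_right_filter/cp|exact/cvg_at_left_filter/cp].
- by move=> y _; rewrite derivE.
Qed.

(** The endpoints of the chord are on the unit circle, where [G] vanishes. If the
chord is empty, both endpoints are taken to be [0]. *)
Lemma chord_integral_deriv (s : R) (G : {poly R[i]}) :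
  (forall t : R, s ^+ 2 + t ^+ 2 = 1 -> complex.Re G.[t%:C] = 0) ->
  (\int[leb]_(t in chord s) (complex.Re (G^`().[t%:C]))%:E = 0)%E.
Proof.
move=> G0.
have ReE (p : {poly R[i]}) t : complex.Re p.[t%:C] = (\poly_(i < size p) complex.Re p`_i).[t].
  rewrite horner_poly horner_coef raddf_sum; apply: eq_bigr => i _.
  by rewrite -rmorphXn; case: (p`_i) => u v /=; rewrite mulr0 subr0.
have ite (p : {poly R[i]}) i : (if (i < size p)%N then complex.Re p`_i else 0) = complex.Re p`_i.
  by case: ltnP => // h; rewrite nth_default.
have dE : \poly_(i < size G^`()) complex.Re G^`()`_i = (\poly_(i < size G) complex.Re G`_i)^`().
  apply/polyP => i; rewrite [LHS](coef_poly (size _)) [RHS]coef_deriv coef_poly.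
  by rewrite !ite coef_deriv raddfMn.
under eq_integral do rewrite ReE dE.
apply: integral_deriv_poly; first exact: sqrtr_ge0.
rewrite -!ReE; set r := Num.sqrt _.
case: (lerP 0 (1 - s ^+ 2)) => h; last by rewrite /r ler0_sqrtr ?ltW // oppr0.
have r2 : r ^+ 2 = 1 - s ^+ 2 by rewrite sqr_sqrtr.
by rewrite !G0 // ?sqrrN r2; ring.
Qed.

Definition disk_ctame (F : R * R -> R[i]) :=
  disk_tame (fun p => complex.Re (F p)) /\ disk_tame (fun p => complex.Im (F p)).

Lemma disk_tame_cst (c : R) : disk_tame (fun _ : R * R => c).
Proof. by split; [exact: measurable_cst|exists `|c|]. Qed.

Lemma disk_tameD (f g : R * R -> R) : disk_tame f -> disk_tame g -> disk_tame (fun p => f p + g p).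
Proof.
move=> [mf [M fM]] [mg [N gN]]; split; first exact: measurable_funD.
by exists (M + N) => p Dp; rewrite (le_trans (ler_normD _ _)) // lerD ?fM ?gN.
Qed.

Lemma disk_tameM (f g : R * R -> R) : disk_tame f -> disk_tame g -> disk_tame (fun p => f p * g p).
Proof.
move=> [mf [M fM]] [mg [N gN]]; split; first exact: measurable_funM.
by exists (M * N) => p Dp; rewrite normrM ler_pM ?fM ?gN.
Qed.

Lemma disk_tame_fst : disk_tame (@fst R R).
Proof.
split; first exact: measurable_fst.
exists 1 => -[x y] /unit_diskE h /=; rewrite ler_norml.
by have := sqr_ge0 y; nra.
Qed.

Lemma disk_tame_snd : disk_tame (@snd R R).
Proof.
split; first exact: measurable_snd.
exists 1 => -[x y] /unit_diskE h /=; rewrite ler_norml.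
by have := sqr_ge0 x; nra.
Qed.

Lemma disk_ctame_cst (c : R[i]) : disk_ctame (fun _ : R * R => c).
Proof. by split; exact: disk_tame_cst. Qed.

Lemma disk_ctameD F G : disk_ctame F -> disk_ctame G -> disk_ctame (fun p => F p + G p).
Proof.
move=> [Fr Fi] [Gr Gi]; split.
  have := disk_tameD Fr Gr; congr disk_tame; apply/funext => p.
  by rewrite raddfD.
have := disk_tameD Fi Gi; congr disk_tame; apply/funext => p.
by rewrite raddfD.
Qed.

Lemma disk_ctameM F G : disk_ctame F -> disk_ctame G -> disk_ctame (fun p => F p * G p).
Proof.
move=> [Fr Fi] [Gr Gi]; split.
  have := disk_tameD (disk_tameM Fr Gr) (disk_tameM (disk_tame_cst (-1)) (disk_tameM Fi Gi)).
  congr disk_tame; apply/funext => p.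
  by case: (F p) => a b; case: (G p) => c d /=; rewrite mulN1r.
have := disk_tameD (disk_tameM Fr Gi) (disk_tameM Fi Gr).
congr disk_tame; apply/funext => p.
by case: (F p) => a b; case: (G p) => c d /=; rewrite addrC.
Qed.

Lemma disk_ctameN F : disk_ctame F -> disk_ctame (fun p => - F p).
Proof.
move=> tF; have := disk_ctameM (disk_ctame_cst (-1)) tF.
by congr disk_ctame; apply/funext => p; rewrite mulN1r.
Qed.

Lemma disk_ctameX F n : disk_ctame F -> disk_ctame (fun p => F p ^+ n).
Proof.
move=> tF; elim: n => [|n IH]; first exact: disk_ctame_cst.
have := disk_ctameM tF IH.
by congr disk_ctame; apply/funext => p; rewrite exprS.
Qed.

Lemma disk_ctame_sum (I : Type) (s : seq I) (F : I -> R * R -> R[i]) :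
  (forall i, disk_ctame (F i)) -> disk_ctame (fun p => \sum_(i <- s) F i p).
Proof.
move=> tF; elim: s => [|i s IH].
  by have := disk_ctame_cst 0; congr disk_ctame; apply/funext => p; rewrite big_nil.
have := disk_ctameD (tF i) IH.
by congr disk_ctame; apply/funext => p; rewrite big_cons.
Qed.

Lemma disk_ctame_z : disk_ctame (fun p : R * R => p.1 +i* p.2).
Proof. by split; [exact: disk_tame_fst|exact: disk_tame_snd]. Qed.

Lemma disk_ctame_zbar : disk_ctame (fun p : R * R => p.1 -i* p.2).
Proof.
split; first exact: disk_tame_fst.
have := disk_tameM (disk_tame_cst (-1)) disk_tame_snd.
by congr disk_tame; apply/funext => p; rewrite mulN1r.
Qed.

Definition disk_Re_integral (F : R * R -> R[i]) : R :=
  \int[mu2]_(p in D) complex.Re (F p).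

Lemma disk_Re_integralD F G : disk_ctame F -> disk_ctame G ->
  disk_Re_integral (fun p => F p + G p) = disk_Re_integral F + disk_Re_integral G.
Proof.
move=> [Fr _] [Gr _]; rewrite /disk_Re_integral -RintegralD.
- by apply: eq_Rintegral => p _; rewrite raddfD.
- exact: measurable_unit_disk.
- exact: disk_tame_integrable.
- exact: disk_tame_integrable.
Qed.

Lemma disk_Re_integralZ (c : R) F : disk_ctame F ->
  disk_Re_integral (fun p => c%:C * F p) = c * disk_Re_integral F.
Proof.
move=> [Fr _]; rewrite /disk_Re_integral -RintegralZl.
- by apply: eq_Rintegral => p _; case: (F p) => a b /=; rewrite mul0r subr0.
- exact: measurable_unit_disk.
- exact: disk_tame_integrable.
Qed.

Lemma disk_Re_integral_sum (I : Type) (s : seq I) (F : I -> R * R -> R[i]) :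
  (forall i, disk_ctame (F i)) ->
  disk_Re_integral (fun p => \sum_(i <- s) F i p) =
  \sum_(i <- s) disk_Re_integral (F i).
Proof.
move=> tF; elim: s => [|i s IH].
  rewrite big_nil /disk_Re_integral -[RHS](mul0r (fine (mu2 D))) -Rintegral_cst.
    by apply: eq_Rintegral => p _; rewrite big_nil.
  exact: measurable_unit_disk.
rewrite big_cons -IH -disk_Re_integralD //; last exact: disk_ctame_sum.
by apply: eq_Rintegral => p _; rewrite big_cons.
Qed.

(** * Orthogonality of the monomials on the disk *)

Definition zmonom (p q : nat) (v : R * R) : R[i] :=
  (v.1 +i* v.2) ^+ p * (v.1 -i* v.2) ^+ q.

Lemma disk_ctame_zmonom p q : disk_ctame (zmonom p q).
Proof.
by apply: disk_ctameM; apply: disk_ctameX; [exact: disk_ctame_z|exact: disk_ctame_zbar].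
Qed.

(** [dz_part] and [dzbar_part] are the derivatives in [z] and in [zbar] of
[(1 - z * zbar) * z ^ p * zbar ^ q]. *)
Definition dz_part p q v : R[i] :=
  p%:R * zmonom p.-1 q v - p.+1%:R * zmonom p q.+1 v.
Definition dzbar_part p q v : R[i] :=
  q%:R * zmonom p q.-1 v - q.+1%:R * zmonom p.+1 q v.

Lemma disk_ctame_dz p q : disk_ctame (dz_part p q).
Proof.
by apply: disk_ctameD; [|apply: disk_ctameN]; (apply: disk_ctameM;
  [exact: disk_ctame_cst|exact: disk_ctame_zmonom]).
Qed.

Lemma disk_ctame_dzbar p q : disk_ctame (dzbar_part p q).
Proof.
by apply: disk_ctameD; [|apply: disk_ctameN]; (apply: disk_ctameM;
  [exact: disk_ctame_cst|exact: disk_ctame_zmonom]).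
Qed.

(** The derivative in [x] is the sum of those in [z] and [zbar]. *)
Lemma disk_integral_dx p q :
  disk_Re_integral (fun v => dz_part p q v + dzbar_part p q v) = 0.
Proof.
have tm := disk_ctameD (disk_ctame_dz p q) (disk_ctame_dzbar p q).
apply: disk_integral_eq0_y => [|y]; first by case: tm.
pose Z : {poly R[i]} := 'X + (0 +i* y)%:P; pose W : {poly R[i]} := 'X - (0 +i* y)%:P.
have ZE (t : R) : Z.[t%:C] = t +i* y by rewrite !hornerE; simpc.
have WE (t : R) : W.[t%:C] = t -i* y by rewrite !hornerE; simpc.
have dZ : Z^`() = 1 by rewrite derivD derivX derivC addr0.
have dW : W^`() = 1 by rewrite derivB derivX derivC subr0.
clearbody Z W.
rewrite -(@chord_integral_deriv y ((1 - Z * W) * (Z ^+ p * W ^+ q))).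
  apply: eq_integral => x _; congr (complex.Re _)%:E.
  rewrite deriv_power_pair dZ dW !mul1r -!polyC_natr !hornerE !ZE !WE /dz_part /dzbar_part /zmonom /=; ring.
move=> t h; rewrite hornerM [X in X * _](_ : _ = 0) ?mul0r //.
rewrite hornerD hornerN hornerM hornerC ZE WE; apply/eqP.
by rewrite eq_complex /=; apply/andP; split; apply/eqP; rewrite -?h; ring.
Qed.

(** The derivative in [y] is [i] times the difference of those in [z] and [zbar];
the integrand is [i] times this derivative. *)
Lemma disk_integral_dy p q :
  disk_Re_integral (fun v => dzbar_part p q v - dz_part p q v) = 0.
Proof.
have tm := disk_ctameD (disk_ctame_dzbar p q) (disk_ctameN (disk_ctame_dz p q)).
apply: disk_integral_eq0_x => [|x]; first by case: tm.
pose I : R[i] := 0 +i* 1; have I2 : I * I = -1 by rewrite /I; simpc.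
pose Z : {poly R[i]} := (x%:C)%:P + I%:P * 'X.
pose W : {poly R[i]} := (x%:C)%:P - I%:P * 'X.
have ZE (t : R) : Z.[t%:C] = x +i* t by rewrite !hornerE /I; simpc.
have WE (t : R) : W.[t%:C] = x -i* t by rewrite !hornerE /I; simpc.
have dZ : Z^`() = I%:P by rewrite derivD derivC deriv_mulC derivX mulr1 add0r.
have dW : W^`() = - I%:P by rewrite derivB derivC deriv_mulC derivX mulr1 sub0r.
clearbody Z W.
rewrite -(@chord_integral_deriv x (I%:P * ((1 - Z * W) * (Z ^+ p * W ^+ q)))).
  apply: eq_integral => y _; congr (complex.Re _)%:E.
  rewrite deriv_mulC deriv_power_pair dZ dW -!polyC_natr !hornerE !ZE !WE.
  rewrite mulNr mulrBr !mulrA I2 /dz_part /dzbar_part /zmonom /=; ring.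
move=> t h; rewrite hornerM [X in _ * X](_ : _ = 0) ?mulr0 //.
rewrite hornerM [X in X * _](_ : _ = 0) ?mul0r //.
rewrite hornerD hornerN hornerM hornerC ZE WE; apply/eqP.
by rewrite eq_complex /=; apply/andP; split; apply/eqP; rewrite -?h; ring.
Qed.

(** This is the vanishing of the integral of [dzbar_part]. For [q = 0] it says
that the integral of [z ^ (p + 1)] is zero, since the right-hand side is multiplied
by [0]. *)
Lemma disk_integral_zmonom_rec p q :
  q.+1%:R * disk_Re_integral (zmonom p.+1 q) = q%:R * disk_Re_integral (zmonom p q.-1).
Proof.
have tz := disk_ctame_dz p q; have tzb := disk_ctame_dzbar p q.
have := disk_integral_dx p q; rewrite disk_Re_integralD //.
have := disk_integral_dy p q; rewrite disk_Re_integralD //; last exact: disk_ctameN.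
have -> : disk_Re_integral (fun v => - dz_part p q v) = - disk_Re_integral (dz_part p q).
  rewrite -mulN1r -disk_Re_integralZ //; apply: eq_Rintegral => v _.
  by rewrite rmorphN1 mulN1r.
move=> h1 h2; have {h1 h2} : disk_Re_integral (dzbar_part p q) = 0 by lra.
have := disk_ctame_zmonom; move=> tm.
have -> : disk_Re_integral (dzbar_part p q) =
   q%:R * disk_Re_integral (zmonom p q.-1) + - q.+1%:R * disk_Re_integral (zmonom p.+1 q).
  rewrite -!disk_Re_integralZ // -disk_Re_integralD; first last.
  - by apply: disk_ctameM => //; exact: disk_ctame_cst.
  - by apply: disk_ctameM => //; exact: disk_ctame_cst.
  by apply: eq_Rintegral => v _; rewrite rmorphN !rmorph_nat mulNr.
by rewrite mulNr => /eqP; rewrite subr_eq0 => /eqP.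
Qed.

(** By conjugation one may assume [q <= p]; the recurrence then lowers both
exponents to [q = 0]. *)
Lemma disk_integral_zmonom p q :
  disk_Re_integral (zmonom p q) = if p == q then pi / p.+1%:R else 0.
Proof.
wlog pq : p q / (q <= p)%N => [wl|].
  case/orP: (leq_total q p) => [/wl //|/wl qp]; rewrite eq_sym.
  have -> : disk_Re_integral (zmonom p q) = disk_Re_integral (zmonom q p).
    apply: eq_Rintegral => -[x y] _; rewrite /zmonom /=.
    have -> : (x +i* y) ^+ p * (x -i* y) ^+ q = ((x +i* y) ^+ q * (x -i* y) ^+ p)^*%C.
      by rewrite rmorphM !rmorphXn /= opprK mulrC.
    by case: (_ * _).
  by rewrite qp; case: eqP => // ->.
elim: q p pq => [|q IH] [|p] //= pq.
- rewrite divr1 /disk_Re_integral /zmonom.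
  under eq_Rintegral => v _ do rewrite !expr0 mulr1 /=.
  rewrite Rintegral_cst; last exact: measurable_unit_disk.
  by rewrite [X in fine X]area_unit_disk mul1r.
- by have := disk_integral_zmonom_rec p 0; rewrite mul0r mul1r.
have := disk_integral_zmonom_rec p q.+1; rewrite /= IH // eqSS.
have n0 k : k.+1%:R != 0 :> R by rewrite pnatr_eq0.
move=> h; apply: (mulfI (n0 q.+1)); rewrite h; case: eqP => [->|_]; last by rewrite !mulr0.
by rewrite !(mulrC _ (pi / _)) !divfK.
Qed.

End Disk.

(** * The moments as polynomials in the coefficients *)

Lemma size_poly_of (R : realType) n (a : 'rV[R]_n) : (size (poly_of a) <= n.+1)%N.
Proof.
apply/(leq_trans (size_sum _ _ _))/bigmax_leqP => i _.
by rewrite (leq_trans (size_scale_leq _ _)) // size_polyXn ltnS.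
Qed.

Lemma horner_complexify (R : realType) (p : {poly R}) m z : (size p <= m)%N ->
  (complexify p).[z] = \sum_(i < m) (p`_i)%:C * z ^+ i.
Proof.
move=> pm; rewrite (@horner_coef_wide _ m); last by rewrite size_map_poly.
by apply: eq_bigr => i _; rewrite coef_map.
Qed.

(** Expand [P ^ k P'] and the conjugate of [P'] on the monomials: only the
diagonal terms survive, and the [j + 1] of [P'] cancels that of
[pi / (j + 1)]. *)
Lemma real_moment_coef (R : realType) n k (a : 'rV[R]_n) :
  real_moment k a = \sum_(j < n) (poly_of a ^+ k * (poly_of a)^`())`_j * a 0 j.
Proof.
set P := poly_of a; set A := P ^+ k * P^`().
have sB : (size P^`() <= n)%N.
  have := size_poly_of a; rewrite -/P => sP.
  case: (eqVneq P 0) => [->|P0]; first by rewrite deriv0 size_poly0.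
  by rewrite -ltnS (leq_trans (lt_size_deriv P0)).
have E : real_moment k a = pi^-1 * disk_Re_integral (fun v => \sum_(i < size A) \sum_(j < n)
    (A`_i * P^`()`_j)%:C * zmonom i j v).
  rewrite /real_moment /complex_moment /disk_integral /= mul0r subr0; congr (_ * _).
  apply: eq_Rintegral => -[x y] _; congr complex.Re; rewrite /= -/P.
  have cd : (complexify P)^`() = complexify P^`() by rewrite /complexify deriv_map.
  rewrite normCK mulrA cd /complexify -[X in X * _](_ : (complexify A).[x +i* y] = _); last first.
    by rewrite /complexify /A rmorphM rmorphXn hornerM horner_exp.
  rewrite (horner_complexify _ (leqnn _)) (horner_complexify _ sB) rmorph_sum.
  rewrite mulr_suml; apply: eq_bigr => i _; rewrite mulr_sumr; apply: eq_bigr => j _.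
  rewrite /zmonom [in RHS]rmorphM rmorphM rmorphXn /=.
  have -> : Num.conj (P^`()`_j)%:C = (P^`()`_j)%:C :> R[i] by rewrite /Num.conj /= oppr0.
  have -> : Num.conj (x +i* y) = x -i* y :> R[i] by [].
  by rewrite /=; ring.
rewrite E disk_Re_integral_sum; last first.
  move=> i; apply: disk_ctame_sum => j; apply: disk_ctameM; first exact: disk_ctame_cst.
  exact: disk_ctame_zmonom.
rewrite mulr_sumr; under eq_bigr => i _.
  rewrite disk_Re_integral_sum; last first.
    by move=> j; apply: disk_ctameM; [exact: disk_ctame_cst|exact: disk_ctame_zmonom].
  rewrite mulr_sumr; over.
rewrite exchange_big; apply: eq_bigr => j _ /=.
have JE (c : R) i l : disk_Re_integral (fun v => c%:C * zmonom i l v) =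
    c * (if i == l then pi / i.+1%:R else 0).
  by rewrite disk_Re_integralZ ?disk_integral_zmonom //; exact: disk_ctame_zmonom.
under eq_bigr => i _ do rewrite JE.
have pi0 : pi != 0 :> R by rewrite gt_eqF ?pi_gt0.
have n0 i : i.+1%:R != 0 :> R by rewrite pnatr_eq0.
have Bj : P^`()`_j = a 0 j * j.+1%:R by rewrite coef_deriv coef_poly_of mulr_natr.
case: (ltnP j (size A)) => jA.
  rewrite (bigD1 (Ordinal jA)) //= eqxx big1 ?addr0; last first.
    by move=> i ij; rewrite ifF ?mulr0 //; apply/negbTE.
  rewrite Bj; move: (n0 j) pi0; move: (j.+1%:R) (pi : R) => d p d0 p0.
  by field; rewrite d0 p0.
rewrite [A`_j]nth_default // mul0r big1 // => i _; rewrite ifF ?mulr0 //.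
by apply/negbTE; rewrite neq_ltn (leq_trans (ltn_ord i) jA).
Qed.

(** Since [(P ^ (k + 1))' = (k + 1) P ^ k P'], the moment depends on the
coefficients only through those of a power of [P] and of [P], with no derivative;
this form is the easier one to differentiate. *)
Lemma real_moment_pow (R : realType) n k (a : 'rV[R]_n) :
  real_moment k a =
  k.+1%:R^-1 * \sum_(j < n) j.+1%:R * ((poly_of a ^+ k.+1)`_j.+1 * (poly_of a)`_j.+1).
Proof.
rewrite real_moment_coef mulr_sumr; apply: eq_bigr => j _.
have h : (poly_of a ^+ k * (poly_of a)^`())`_j *+ k.+1 =
    (poly_of a ^+ k.+1)`_j.+1 *+ j.+1.
  by rewrite -coef_deriv deriv_exp mulrC coefMn.
have n0 : k.+1%:R != 0 :> R by rewrite pnatr_eq0.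
apply: (mulfI n0); rewrite [LHS]mulrA [k.+1%:R * _]mulr_natl h coef_poly_of.
by rewrite [RHS]mulrA divff // mul1r [RHS]mulrA mulr_natl.
Qed.

(** * The Jacobian matrix *)

Lemma is_derive_affine (R : realType) (V : normedModType R) (f : V -> R) (a w : V) (df : R) :
  (forall h : R, f (h *: w + a) = h * df + f a) -> is_derive a w f df.
Proof.
move=> fE.
have cvgf : ((h^-1 *: ((f \o shift a) (h *: w) - f a)) @[h --> (0:R)^'] --> df)%classic.
  apply: cvg_near_cst; near=> h.
  rewrite /= fE addrK /GRing.scale /= mulrA mulVf ?mul1r //.
  by near: h; exact: nbhs_dnbhs_neq.
by split; [apply/cvg_ex; exists df|apply/cvg_lim].
Unshelve. all: by end_near. Qed.

Section CoefDerive.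
Variables (R : realType) (V : normedModType R) (a w : V).

(** Differentiability of a family of polynomials in the sense of coefficients,
which spares a topology on the space of polynomials. *)
Definition coef_derive (A : V -> {poly R}) (dA : {poly R}) :=
  forall l, is_derive a w (fun b => (A b)`_l) dA`_l.

Lemma coef_deriveM A B dA dB : coef_derive A dA -> coef_derive B dB ->
  coef_derive (fun b => A b * B b) (A a * dB + dA * B a).
Proof.
move=> hA hB l.
have -> : (fun b => (A b * B b)`_l) =
   \sum_(j < l.+1) ((fun b => (A b)`_j) * (fun b => (B b)`_(l - j))).
  by apply/funext => b; rewrite coefM fct_sumE.
apply: (is_derive_eq (is_derive_sum (fun j : 'I_l.+1 => is_deriveM (hA j) (hB (l - j)%N)))).
rewrite coefD !coefM -big_split /=.
by apply: eq_bigr => j _; rewrite /GRing.scale /= [X in _ + X]mulrC.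
Qed.

Lemma coef_deriveX A dA k : coef_derive A dA ->
  coef_derive (fun b => A b ^+ k) (k%:R * A a ^+ k.-1 * dA).
Proof.
move=> hA; elim: k => [|k IH] l.
  apply: (is_derive_eq (is_derive_cst (1 : {poly R})`_l a w)).
  by rewrite !mul0r coef0.
have -> : (fun b => (A b ^+ k.+1)`_l) = (fun b => (A b * A b ^+ k)`_l).
  by apply/funext => b; rewrite exprS.
suff -> : k.+1%:R * A a ^+ k.+1.-1 * dA =
    A a * (k%:R * A a ^+ k.-1 * dA) + dA * A a ^+ k.
  exact: (coef_deriveM hA IH l).
case: k {IH} => [|k] /=; first by ring.
rewrite exprS; ring.
Qed.
End CoefDerive.

Lemma coef_poly_ofE (R : realType) n (a : 'rV[R]_n) l :
  (poly_of a)`_l = \sum_(v < n) a 0 v * (l == v.+1)%:R.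
Proof. by rewrite coef_sum; apply: eq_bigr => v _; rewrite coefZ coefXn. Qed.

Lemma coef_derive_poly_of (R : realType) n (a w : 'rV[R]_n) :
  coef_derive a w (@poly_of R n) (poly_of w).
Proof.
move=> l; apply: is_derive_affine => h.
rewrite !coef_poly_ofE mulr_sumr -big_split; apply: eq_bigr => v _ /=.
by rewrite !mxE mulrDl mulrA.
Qed.

(** This is the constant term of [P ^ k * u_v]. The Toeplitz part comes from
the variation of the last factor of the moment, the Hankel part from that of the
power of [P]. *)
Lemma derive_real_moment (R : realType) m k (a : 'rV[R]_m.+1) (v : 'I_m.+1) :
  'D_(delta_mx 0 v) (@real_moment R m.+1 k) a =
  \sum_(l < m.+1) (poly_of a ^+ k)`_l * toeplitz_hankel_mx m (poly_of a)^`() v l.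
Proof.
set P := poly_of a; set w := delta_mx 0 v.
have wE : poly_of w = 'X^(v.+1).
  rewrite /poly_of (bigD1 v) //= big1 ?addr0 => [|i iv]; rewrite mxE eqxx /=.
    by rewrite eqxx scale1r.
  by rewrite (negbTE iv) scale0r.
have n0 : k.+1%:R != 0 :> R by rewrite pnatr_eq0.
have /(@derive_val _ _ _ _ _ _ _) -> : is_derive a w (@real_moment R m.+1 k)
  (k.+1%:R^-1 * \sum_(j < m.+1) j.+1%:R *
     ((P ^+ k.+1)`_j.+1 * (poly_of w)`_j.+1 + P`_j.+1 * (k.+1%:R * P ^+ k * poly_of w)`_j.+1)).
  have -> : @real_moment R m.+1 k = k.+1%:R^-1 \*: \sum_(j < m.+1) j.+1%:R \*:
      ((fun b : 'rV[R]_m.+1 => (poly_of b ^+ k.+1)`_j.+1) * (fun b => (poly_of b)`_j.+1)).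
    by apply/funext => b; rewrite real_moment_pow /= fct_sumE.
  apply: is_deriveZ; apply: is_derive_sum => j; apply: is_deriveZ.
  apply: is_deriveM; first exact: (coef_deriveX k.+1 (coef_derive_poly_of a w)).
  exact: coef_derive_poly_of.
have cP j : j.+1%:R * P`_j.+1 = P^`()`_j by rewrite coef_deriv mulr_natl.
rewrite wE; under eq_bigr => j _ do rewrite mulrDr.
rewrite big_split mulrDr /=.
under [RHS]eq_bigr => l _ do rewrite mxE mulrDr.
rewrite [RHS]big_split /=; congr (_ + _).
- rewrite (bigD1 v) //= coefXn eqxx big1 ?addr0; last first.
    by move=> j jv; rewrite coefXn eqSS (negbTE (_ : j != v :> nat)) // !mulr0.
  have E : v.+1%:R * (P ^+ k.+1)`_v.+1 = k.+1%:R * (P ^+ k * P^`())`_v.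
    by rewrite !mulr_natl -coef_deriv deriv_exp coefMn [P^`() * _]mulrC.
  rewrite mulr1 E mulKf // coefM.
  rewrite (big_ord_widen m.+1 (fun l => (P ^+ k)`_l * P^`()`_(v - l))) // big_mkcond /=.
  by apply: eq_bigr => l _; rewrite ltnS; case: ifP; rewrite ?mulr0.
- rewrite mulr_sumr.
  transitivity (\sum_(0 <= j < m.+1 | (v <= j)%N) (P ^+ k)`_(j - v) * P^`()`_j).
    rewrite big_mkord [RHS]big_mkcond; apply: eq_bigr => j _.
    rewrite -cP coefMXn ltnS subSS; case: (leqP v j) => vj; last by rewrite !mulr0.
    rewrite -polyC_natr coefCM; move: (P`_j.+1) => u; by field.
  rewrite -(big_nat_widenl v 0 m.+1 xpredT) // -{1}[v : nat]add0n big_addn.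
  rewrite -(big_mkord xpredT (fun l => (P ^+ k)`_l * P^`()`_(v + l))).
  rewrite [RHS](big_cat_nat (n := (m.+1 - v)%N)) //= ?leq_subr //.
  rewrite [X in _ = _ + X]big_nat_cond [X in _ = _ + X]big1 ?addr0.
    by apply: eq_bigr => l _; rewrite addnK addnC.
  move=> l /andP[/andP[vl _] _]; rewrite [X in _ * X]nth_default ?mulr0 //.
  apply: leq_trans (size_poly _ _) _.
  have := size_poly_of a; rewrite -/P; lia.
Qed.

Lemma coef_exp_order1 (S : comNzRingType) (P : {poly S}) k l : P`_0 = 0 ->
  (l <= k)%N -> (P ^+ k)`_l = if l == k then P`_1 ^+ k else 0.
Proof.
move=> P0 lk; have -> : P = 'X * drop_poly 1 P.
  apply/polyP => -[|i]; rewrite coefXM //= coef_drop_poly addn1 //.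
rewrite exprMn coefXnM coefXM /= coef_drop_poly.
case: (ltngtP l k) lk => // -> _; rewrite subnn -!horner_coef0 horner_exp.
by rewrite horner_coef0 coef_drop_poly.
Qed.

(** The coefficients of degree [l < k] of [P ^ k] vanish, so the matrix of the
coefficients of the powers of [P] is triangular. *)
Lemma moment_jacobianE (R : realType) m (a : 'rV[R]_m.+1) :
  moment_jacobian a =
  (\prod_(k < m.+1) (poly_of a)`_1 ^+ k) * \det (toeplitz_hankel_mx m (poly_of a)^`()).
Proof.
set P := poly_of a.
have P0 : P`_0 = 0 by rewrite coef_poly_ofE big1 // => v _; rewrite mulr0.
rewrite /moment_jacobian.
have -> : \matrix_(k < m.+1, v < m.+1) 'D_(delta_mx 0 v) (@real_moment R m.+1 k) a =
    (\matrix_(l < m.+1, k < m.+1) (P ^+ k)`_l)^T *m (toeplitz_hankel_mx m P^`())^T.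
  apply/matrixP => k v; rewrite !mxE derive_real_moment.
  by apply: eq_bigr => l _; rewrite !mxE.
rewrite det_mulmx !det_tr; congr (_ * _); rewrite det_trig.
  by apply: eq_bigr => k _; rewrite mxE coef_exp_order1 // eqxx.
apply/is_trig_mxP => l k lk.
by rewrite mxE (coef_exp_order1 P0 (ltnW lk)) ltn_eqF.
Qed.

Unset Implicit Arguments.

Theorem theorem2 (R : realType) (n : nat) (hn : (2 <= n)%N) (a : 'rV[R]_n)
    (ha1 : 0 < (poly_of a)`_1) (han : (poly_of a)`_n != 0) :
  let P' := (complexify (poly_of a))^`() in
  (moment_jacobian a)%:C ^+ 2 =
    4 * (-1) ^+ n.-1 * ((poly_of a)`_1)%:C ^+ (n * n.-1) *
    root_resultant P' (reciprocal P') * P'.[-1] * P'.[1].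
Proof.
move=> P'; case: n hn a ha1 han @P' => // m _ a ha1 han P'.
have P'E : P' = complexify (poly_of a)^`() by rewrite /complexify -deriv_map.
have coefP' i : P'`_i = ((poly_of a)^`()`_i)%:C by rewrite P'E coef_map.
have P'0 : P'`_0 != 0.
  by rewrite coefP' coef_deriv mulr1n fmorph_eq0 gt_eqF.
have P'm : P'`_m != 0.
  by rewrite coefP' coef_deriv fmorph_eq0 mulrn_eq0 negb_or han.
have sP' : size P' = m.+1.
  apply/eqP; rewrite eqn_leq; apply/andP; split.
    apply: leq_trans (size_poly _ _) _; rewrite size_map_poly.
    by rewrite -subn1 leq_subLR add1n size_poly_of.
  by rewrite ltnNge; apply: contraNN P'm => h; rewrite nth_default.
have detE : (\det (toeplitz_hankel_mx m (poly_of a)^`()))%:C = \det (toeplitz_hankel_mx m P').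
  by rewrite P'E map_toeplitz_hankel_mx det_map_mx.
have sumE : ((\sum_(k < m.+1) k) * 2 = m.+1 * m)%N.
  elim: (m) => [|j IH]; first by rewrite big_ord_recr big_ord0.
  by rewrite big_ord_recr mulnDl IH /=; lia.
rewrite moment_jacobianE prodrXr rmorphM exprMn rmorphXn -exprM sumE /= detE.
by rewrite (det_toeplitz_hankel_mx_resultant sP' P'0) /=; ring.
Qed.
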